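(* Let $\alpha>0$, $\beta>0$, $n\ge0$ an integer. For real $\lambda\neq0$, the auxiliary variables $R_n(\lambda)$ and $r_n(\lambda)$ satisfy the nonlinear second order ordinary differential equations (with $'=d/d\lambda$) $$\begin{aligned}R_n''=\frac{1}{2\lambda^2(R_n-\lambda)R_n}\Big\{&(2R_n-\lambda)(\lambda R_n')^2-2\lambda R_n^2R_n'+2R_n^5-2\alpha^2\lambda^2R_n+\alpha^2\lambda^3\\&-[2(2n+1+\alpha+\beta)+5\lambda]R_n^4+4\lambda(2n+1+\alpha+\beta+\lambda)R_n^3\\&-[\lambda^3-\lambda(1+\alpha^2-\beta^2)+2\lambda^2(2n+1+\alpha+\beta)]R_n^2\Big\},\end{aligned}$$ $$\begin{aligned}&\big[\lambda^2r_n''+8r_n^3+6(2n-\alpha+\beta)r_n^2+4(n^2-2n\alpha+n\beta-\alpha\beta)r_n-2n(n+\beta)\alpha+\lambda r_n'\big]^2\\&\qquad=(4r_n+\lambda+2n-\alpha+\beta)^2\left[4r_n(r_n-\alpha)(r_n+n)(r_n+n+\beta)+(\lambda r_n')^2\right].\end{aligned}$$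
   Context: $w(x)=x^{\alpha}(1-x)^{\beta}e^{-\lambda x}$ on $[0,1]$; $P_n$ is the monic orthogonal polynomial of degree $n$ for $w$ on $[0,1]$ (depending on $\lambda$), and $h_n=\int_0^1P_n^2w\,dx$. The auxiliary quantities are $$R_n(\lambda)=\frac{\alpha}{h_n}\int_0^1\frac{P_n^2(y)}{y}w(y)\,dy,\qquad r_n(\lambda)=\frac{\alpha}{h_{n-1}}\int_0^1\frac{P_n(y)P_{n-1}(y)}{y}w(y)\,dy\ (n\ge1),\qquad r_0:=0.$$ *)

(* Defs.v *)
From mathcomp Require Export all_boot all_order all_algebra.
From mathcomp Require Export all_classical all_reals all_analysis.
Export Order.TTheory GRing.Theory Num.Theory.
Export numFieldNormedType.Exports.

Set Implicit Arguments.
Unset Strict Implicit.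
Unset Printing Implicit Defensive.

Local Open Scope classical_set_scope.
Local Open Scope ring_scope.

Definition weight (R : realType) (alpha beta lambda x : R) : R :=
  x `^ alpha * (1 - x) `^ beta * expR (- (lambda * x)).

Definition wint (R : realType) (w f : R -> R) : R :=
  \int[@lebesgue_measure R]_(x in `[0, 1]) (f x * w x).

Definition monic_orthogonal (R : realType) (w : R -> R)
    (P : nat -> {poly R}) : Prop :=
  (forall n, P n \is monic /\ size (P n) = n.+1) /\
  (forall m n, m <> n -> wint w (fun x => (P m).[x] * (P n).[x]) = 0).

(* Below, [P lambda n] is the polynomial of degree [n] for the parameter
   [lambda]. The quotients by [y] take the value 0 at [y = 0], which is
   harmless since a single point has measure zero. *)

Definition hnorm (R : realType) (alpha beta : R) (P : R -> nat -> {poly R})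
    (n : nat) (lambda : R) : R :=
  wint (weight alpha beta lambda) (fun y => (P lambda n).[y] ^+ 2).

Definition Rn (R : realType) (alpha beta : R) (P : R -> nat -> {poly R})
    (n : nat) (lambda : R) : R :=
  alpha / hnorm alpha beta P n lambda *
  wint (weight alpha beta lambda) (fun y => (P lambda n).[y] ^+ 2 / y).

Definition rn (R : realType) (alpha beta : R) (P : R -> nat -> {poly R})
    (n : nat) (lambda : R) : R :=
  if n is k.+1 then
    alpha / hnorm alpha beta P k lambda *
    wint (weight alpha beta lambda)
      (fun y => (P lambda k.+1).[y] * (P lambda k).[y] / y)
  else 0.

(* Main.v *)
Require Import Defs.
From HB Require Import structures.
From mathcomp Require Import measurable_realfun ring lra.

Set Implicit Arguments.
Unset Strict Implicit.
Unset Printing Implicit Defensive.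

Local Open Scope ring_scope.

(** With [w] the weight, put [L Q = \int Q w], [M Q = alpha \int Q w / y] and
    [N Q = beta \int Q w / (1 - y)] for a polynomial [Q]. Integrating [(Q w)']
    gives [L Q' + M Q - N Q = lambda L Q], while [M (X Q) = alpha L Q] and
    [N ((1 - X) Q) = beta L Q]. Write [p_n] for the subleading coefficient of
    [P_n], [a_n = p_n - p_(n+1)] and [b_n = h_n / h_(n-1)] for the recurrence
    coefficients. Taking [Q = X P_n^2] and [Q = X P_n P_(n-1)] yields
    [R_n = 2 n + 1 + alpha + beta + lambda - lambda a_n] and
    [r_n = - n - p_n - lambda b_n]. Reducing [P_n^2] and [P_n P_(n-1)] modulo
    [X], resp. [1 - X], yields [r_n (r_n - alpha) = b_n R_n R_(n-1)] and
    [(r_n + n) (r_n + n + beta) = b_n (R_n - lambda) (R_(n-1) - lambda)].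

    In the parameter, [d/dlambda (L Q) = - L (X Q)] gives [p_n' = b_n] and
    [h_n' = - a_n h_n]. Together these facts form a closed first order system
    for [(R_n, r_n)], valid for [lambda <> 0], whose denominators do not vanish
    because [R_n = M (P_n^2) / h_n > 0] and
    [R_n - lambda = N (P_n^2) / h_n > 0]. Differentiating it once more and
    eliminating one of the two unknowns gives the two equations. *)

(** * Orthogonal polynomials and ladder identities *)

Section OrthogonalPolynomials.
Context {F : fieldType} {L : {scalar {poly F}}} {P : nat -> {poly F}}.
Hypothesis P_monic : forall n, P n \is monic.
Hypothesis P_size : forall n, size (P n) = n.+1.
Hypothesis P_orth : forall m n, m <> n -> L (P m * P n) = 0.
Hypothesis L_sqr : forall Q : {poly F}, Q != 0 -> L (Q * Q) != 0.

Lemma coef_lead n : (P n)`_n = 1.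
Proof. by have /monicP := P_monic n; rewrite lead_coefE P_size. Qed.

Lemma size_sub_lead (Q : {poly F}) n :
  (size Q <= n.+1)%N -> (size (Q - Q`_n *: P n)%R <= n)%N.
Proof.
move=> sQ; apply/leq_sizeP => j; rewrite leq_eqVlt => /predU1P[<-|nj].
  by rewrite coefB coefZ coef_lead mulr1 subrr.
rewrite coefB coefZ [Q`_j]nth_default; last exact: leq_trans sQ nj.
by rewrite [(P n)`_j]nth_default ?P_size// mulr0 subr0.
Qed.

(** As [P k] is monic of degree [k], subtracting a multiple of [P m] lowers the size of [Q]; by
    induction [P 0], ..., [P (m-1)] span the polynomials of size at most [m]. *)
Lemma orth_span (D : {poly F}) m : (forall k, (k < m)%N -> L (D * P k) = 0) ->
  forall Q : {poly F}, (size Q <= m)%N -> L (D * Q) = 0.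
Proof.
elim: m => [|m IH] Dm Q sQ.
  by move: sQ; rewrite leqn0 size_poly_eq0 => /eqP ->; rewrite mulr0 linear0.
rewrite -[Q](subrK (Q`_m *: P m)) mulrDr linearD -scalerAr [L (_ *: (D * _))]linearZ/=.
rewrite Dm// mulr0 addr0 IH//; last exact: size_sub_lead.
by move=> k km; apply: Dm; rewrite (ltn_trans km).
Qed.

Lemma orth_low n (Q : {poly F}) : (size Q <= n)%N -> L (P n * Q) = 0.
Proof.
by apply: orth_span => k kn; apply: P_orth => nk; rewrite nk ltnn in kn.
Qed.

Lemma orth_lead n (Q : {poly F}) : (size Q <= n.+1)%N ->
  L (P n * Q) = Q`_n * L (P n * P n).
Proof.
move=> sQ; rewrite -[in LHS](subrK (Q`_n *: P n) Q) mulrDr linearD.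
by rewrite (orth_low (size_sub_lead sQ)) add0r -scalerAr [L (_ *: (_ * _))]linearZ.
Qed.

Lemma P_neq0 n : P n != 0. Proof. exact: monic_neq0. Qed.

Definition sqnorm n := L (P n * P n).

Lemma sqnorm_neq0 n : sqnorm n != 0. Proof. exact: L_sqr (P_neq0 n). Qed.

(** The value [0] at [n = 0], like [rec_b 0 = 0], lets the three-term recurrence and the ladder
    identities hold uniformly in [n]. *)
Definition prevP n := if n is k.+1 then P k else 0.
Definition rec_b n := if n is k.+1 then sqnorm n / sqnorm k else 0.
Definition rec_a n := L ('X * (P n * P n)) / sqnorm n.
Definition sublead n := if n is k.+1 then (P n)`_k else 0.

Lemma size_X_sub n : (size ('X * P n - P n.+1)%R <= n.+1)%N.
Proof.
apply/leq_sizeP => j; rewrite leq_eqVlt => /predU1P[<-|nj].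
  by rewrite coefB coefXM/= !coef_lead subrr.
rewrite coefB coefXM; case: j nj => // j nj.
by rewrite !nth_default ?subr0// P_size.
Qed.

Lemma L_X_succ n : L ('X * (P n.+1 * P n)) = sqnorm n.+1.
Proof.
have -> : 'X * (P n.+1 * P n) = P n.+1 * ('X * P n) by ring.
rewrite orth_lead ?coefXM/= ?coef_lead ?mul1r//.
by rewrite mulrC size_mulX ?P_size// P_neq0.
Qed.

(** Pair ['X * P n - P n.+1], of degree at most [n], with [P n]: only its coefficient of degree [n]
    counts. *)
Lemma rec_aE n : rec_a n = sublead n - sublead n.+1.
Proof.
have /orth_lead := size_X_sub n.
rewrite coefB coefXM mulrBr linearB/= (@P_orth n n.+1); last exact: n_Sn.
rewrite subr0 mulrCA -/(sqnorm n) /rec_a => ->; rewrite mulfK ?sqnorm_neq0//.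
by case: n.
Qed.

(** The difference [D] of the two sides has degree at most [n] and is orthogonal to every [P k] with
    [k <= n]: the two coefficients are chosen for [k = n] and [k = n - 1], and for smaller [k] the
    degree of ['X * P k] is below [n]. Hence [D] is orthogonal to itself and vanishes. *)
Lemma three_term n :
  P n.+1 = 'X * P n - rec_a n *: P n - rec_b n *: prevP n.
Proof.
set D := 'X * P n - P n.+1 - rec_a n *: P n - rec_b n *: prevP n.
suff : D = 0.
  by rewrite /D => /eqP; rewrite subr_eq0 => /eqP <-; ring.
have sD : (size D <= n.+1)%N.
  rewrite /D (leq_trans (size_polyD _ _))// geq_max size_polyN; apply/andP; split.
    rewrite (leq_trans (size_polyD _ _))// geq_max size_polyN size_X_sub.
    by rewrite (leq_trans (size_scale_leq _ _))// P_size.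
  rewrite (leq_trans (size_scale_leq _ _))//.
  by case: (n) => [|k]; rewrite /= ?size_poly0 ?P_size.
apply/eqP; apply: contraT => /L_sqr; rewrite (orth_span _ sD) ?eqxx// => k kn.
have DE : L (D * P k) = L (P n * ('X * P k)) - L (P n.+1 * P k)
   - rec_a n * L (P n * P k) - rec_b n * L (prevP n * P k).
  rewrite /D !mulrBl !linearB/= -!scalerAl ![L (_ *: (_ * _))]linearZ/=.
  by rewrite (mulrCA (P n)) mulrA.
rewrite {}DE; clear D sD.
rewrite (@P_orth n.+1); last by move=> nk; rewrite nk ltnn in kn.
move: kn; rewrite ltnS leq_eqVlt => /predU1P[->|kn].
  rewrite mulrCA -/(sqnorm n) -[L ('X * _)](@divfK _ (sqnorm n)) ?sqnorm_neq0//.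
  rewrite -/(rec_a n) subr0 subrr sub0r; case: n => [|n] /=.
    by rewrite mul0r oppr0.
  by rewrite P_orth ?mulr0 ?oppr0//; exact: n_Sn.
rewrite (@P_orth n k); last by move=> nk; rewrite nk ltnn in kn.
case: n kn => // n; rewrite ltnS leq_eqVlt => /predU1P[->|kn] /=.
  rewrite mulrCA L_X_succ -/(sqnorm n) divfK ?sqnorm_neq0//.
  by rewrite mulr0 !subr0 subrr.
rewrite (@P_orth n k); last by move=> nk; rewrite nk ltnn in kn.
rewrite !mulr0 !subr0 orth_low//.
by rewrite mulrC size_mulX ?P_neq0// P_size.
Qed.

(** The top coefficient of the quotient is recorded because the exact value of [L (P n * S)] depends
    on it in [reduce_succ]. *)
Lemma divide_at (x : F) (Q : {poly F}) m : (size Q <= m.+2)%N ->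
  exists S : {poly F}, [/\ Q = Q.[x]%:P + ('X - x%:P) * S,
    (size S <= m.+1)%N & S`_m = Q`_m.+1].
Proof.
move=> sQ; have /factor_theorem[S QS] : root (Q - Q.[x]%:P) x.
  by rewrite /root !hornerE subrr.
have QE : Q = Q.[x]%:P + ('X - x%:P) * S by rewrite mulrC -QS addrC subrK.
have sS : (size S <= m.+1)%N.
  have [->|S0] := eqVneq S 0; first by rewrite size_poly0.
  have : (size (S * ('X - x%:P))%R <= m.+2)%N.
    rewrite -QS (leq_trans (size_polyD _ _))// geq_max size_polyN sQ/=.
    by rewrite (leq_trans (size_polyC_leq1 _)).
  by rewrite size_Mmonic ?monicXsubC// size_XsubC addn2.
exists S; split=> //.
rewrite [Q in RHS]QE coefD coefC/= add0r mulrBl coefB coefXM/= coefCM.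
by rewrite [S`_m.+1]nth_default// mulr0 subr0.
Qed.

(* Modulo [X - x] the functional [K] only sees the value at [x], up to [L]:
   this is how a pole of the weight at [x] produces a quadratic relation. *)
Section PointReduction.
Context {K : {scalar {poly F}}} {x c : F}.
Hypothesis K_reduce : forall S, K (('X - x%:P) * S) = c * L S.

Lemma reduce_low n (Q : {poly F}) : (size Q <= n.+1)%N ->
  K (P n * Q) = Q.[x] * K (P n).
Proof.
case: n => [|n] sQ.
  by rewrite (size1_polyC sQ) hornerC mulrC mul_polyC linearZ.
have [S [QE sS _]] := divide_at x sQ.
rewrite [in LHS]QE mulrDr linearD mulrC mul_polyC linearZ/= mulrCA.
by rewrite K_reduce orth_low// mulr0 addr0.
Qed.

Lemma reduce_succ n : K (P n.+1 * P n) = (P n.+1).[x] * K (P n) + c * sqnorm n.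
Proof.
have [|S [PE sS Sn]] := @divide_at x (P n.+1) n; first by rewrite P_size.
rewrite mulrC [in LHS]PE mulrDr linearD [X in K X + _]mulrC mul_polyC linearZ/=.
by rewrite mulrCA K_reduce orth_lead// Sn coef_lead mul1r.
Qed.

(** The mixed value reduces in two ways: onto [P n.+1], giving [u] as a multiple of [(P n).[x] * K
    (P n.+1)], and onto [P n], giving [u - c] as a multiple of [(P n.+1).[x] * K (P n)]. The four
    factors of the product regroup into the two diagonal values. *)
Lemma reduce_quadratic n (u := K (P n.+1 * P n) / sqnorm n) :
  u * (u - c) = rec_b n.+1 *
    (K (P n.+1 * P n.+1) / sqnorm n.+1 * (K (P n * P n) / sqnorm n)).
Proof.
have h0 := sqnorm_neq0 n; have h1 := sqnorm_neq0 n.+1.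
have uc : u - c = (P n.+1).[x] * K (P n) / sqnorm n.
  by rewrite /u reduce_succ; field.
rewrite uc /u !reduce_low ?P_size//=.
by field; rewrite h0 h1.
Qed.

End PointReduction.

(* [M] and [N] stand for the integrals against [a w / y] and [b w / (1 - y)]. *)
Section LadderIdentities.
Context {M N : {scalar {poly F}}} {a b l : F}.
Hypothesis M_mulX : forall Q, M ('X * Q) = a * L Q.
Hypothesis N_mulX1 : forall Q, N ((1 - 'X) * Q) = b * L Q.
Hypothesis pearson : forall Q : {poly F}, L Q^`() + M Q - N Q = l * L Q.

(** These are the quantities R_n and r_n, with the factor alpha absorbed in [M]. *)
Definition auxR n := M (P n * P n) / sqnorm n.
Definition auxr n := if n is k.+1 then M (P k.+1 * P k) / sqnorm k else 0.

Lemma size_derivP n : (size (P n)^`() <= n)%N.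
Proof. by have := lt_size_deriv (P_neq0 n); rewrite P_size. Qed.

Lemma size_X_derivP n : (size ('X * (P n)^`())%R <= n.+1)%N.
Proof.
have [->|d0] := eqVneq (P n)^`() 0; first by rewrite mulr0 size_poly0.
by rewrite mulrC size_mulX// ltnS size_derivP.
Qed.

Lemma orth_derivP n : L (P n * (P n)^`()) = 0.
Proof. exact: orth_low (size_derivP n). Qed.

(** The relation [pearson] at the square of [P n]: the derivative term vanishes, since the
    derivative of [P n] has lower degree than [P n]. *)
Lemma N_sqr_quotient n : N (P n * P n) / sqnorm n = auxR n - l.
Proof.
have h0 := sqnorm_neq0 n; have := pearson (P n * P n).
rewrite derivM linearD/= [_^`() * _]mulrC orth_derivP !add0r -/(sqnorm n) => e.
have -> : N (P n * P n) = M (P n * P n) - l * sqnorm n by rewrite -e; ring.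
by rewrite /auxR; field.
Qed.

Lemma L_derivP n : L ((P n.+1)^`() * P n) = n.+1%:R * sqnorm n.
Proof.
rewrite mulrC orth_lead; last exact: size_derivP.
by rewrite coef_deriv coef_lead.
Qed.

(** In [pearson] at [P n.+1 * P n] the right side vanishes by orthogonality, and the derivative
    contributes the leading coefficient [n.+1] of the derivative of [P n.+1]. *)
Lemma N_succ_quotient n : N (P n.+1 * P n) / sqnorm n = auxr n.+1 + n.+1%:R.
Proof.
have h0 := sqnorm_neq0 n; have := pearson (P n.+1 * P n).
rewrite derivM linearD/= L_derivP P_orth; last exact/nesym/n_Sn.
rewrite orth_low; last exact: leqW (size_derivP n).
move=> e.
have -> : N (P n.+1 * P n) = M (P n.+1 * P n) + n.+1%:R * sqnorm n.
  by apply/eqP; rewrite eq_sym -subr_eq0 -(mulr0 l) -e; apply/eqP; ring.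
by rewrite /auxr; field.
Qed.

Lemma auxR_rec_a n : l * rec_a n = 2 * n%:R + 1 + a + b + l - auxR n.
Proof.
have h0 := sqnorm_neq0 n; have := pearson ('X * (P n * P n)).
rewrite M_mulX.
(* The splitting is wanted only under [N], where [N_mulX1] applies; elsewhere it is folded back at
   once. *)
have -> : 'X * (P n * P n) = P n * P n - (1 - 'X) * (P n * P n) by ring.
rewrite [N _]linearB/= N_mulX1.
have -> : P n * P n - (1 - 'X) * (P n * P n) = 'X * (P n * P n) by ring.
have -> : ('X * (P n * P n))^`() = P n * P n + P n * ('X * (P n)^`()) *+ 2.
  by rewrite !derivM derivX; ring.
rewrite linearD linearMn/= [L (P n * ('X * _))]orth_lead; last exact: size_X_derivP.
have -> : ('X * (P n)^`())`_n = n%:R.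
  by rewrite coefXM; case: n {h0} => //= n; rewrite coef_deriv coef_lead.
rewrite -/(sqnorm n).
have -> : N (P n * P n) = (auxR n - l) * sqnorm n by rewrite -N_sqr_quotient divfK.
have -> : L ('X * (P n * P n)) = rec_a n * sqnorm n by rewrite divfK.
move=> e; apply: (mulIf h0); rewrite -mulrA -e.
by ring.
Qed.

Lemma auxr_sublead n : auxr n = - n%:R - sublead n - l * rec_b n.
Proof.
case: n => [|n]; first by rewrite /= mulr0 !subr0 oppr0.
have h0 := sqnorm_neq0 n; have := pearson ('X * (P n.+1 * P n)).
rewrite M_mulX.
have -> : 'X * (P n.+1 * P n) = P n.+1 * P n - (1 - 'X) * (P n.+1 * P n) by ring.
rewrite [N _]linearB/= N_mulX1.
have -> : P n.+1 * P n - (1 - 'X) * (P n.+1 * P n) = 'X * (P n.+1 * P n) by ring.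
(* The grouping makes each term computable by degree: subtracting [n.+1] times [P n.+1] cancels the
   leading term of ['X] times its derivative, leaving minus the subleading coefficient in degree
   [n]. *)
have -> : ('X * (P n.+1 * P n))^`() = P n.+1 * P n + P n.+1 * ('X * (P n)^`())
    + P n * ('X * (P n.+1)^`() - n.+1%:R *: P n.+1) + n.+1%:R *: (P n.+1 * P n).
  by rewrite !derivM derivX -!mul_polyC; ring.
rewrite ![L (_ + _)]linearD [L (_ *: (_ * _))]linearZ/=.
rewrite (P_orth (@nesym _ _ _ (@n_Sn n))).
rewrite [L (P n.+1 * ('X * _))]orth_low; last exact: size_X_derivP.
rewrite [L (P n * ('X * _ - _))]orth_lead; last first.
  apply/leq_sizeP => j; rewrite leq_eqVlt => /predU1P[<-|nj].
    by rewrite coefB coefXM coefZ /= coef_deriv coef_lead mulr1 subrr.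
  case: j nj => // j nj; rewrite coefB coefXM coefZ coef_deriv/=.
  by rewrite nth_default ?P_size// mul0rn mulr0 subrr.
have -> : ('X * (P n.+1)^`() - n.+1%:R *: P n.+1)`_n = - (P n.+1)`_n.
  rewrite coefB coefXM coefZ.
  case: (n) => [|m]; first by rewrite mul1r sub0r.
  by rewrite /= coef_deriv mulr_natl [_ *+ m.+2]mulrSr opprD addrA subrr sub0r.
rewrite L_X_succ -/(sqnorm n) -/(rec_b n.+1) -/(auxr n.+1).
have -> : N (P n.+1 * P n) = (auxr n.+1 + n.+1%:R) * sqnorm n.
  by rewrite -N_succ_quotient divfK.
have -> : sqnorm n.+1 = rec_b n.+1 * sqnorm n by rewrite divfK.
move=> /eqP; rewrite -subr_eq0 => /eqP e; apply: (mulIf h0).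
by apply/eqP; rewrite -subr_eq0 -[X in _ == X]oppr0 -[X in _ == - X]e; apply/eqP; ring.
Qed.

Lemma auxr_quadratic0 n :
  auxr n * (auxr n - a) = rec_b n * (auxR n * auxR n.-1).
Proof.
case: n => [|n] /=; first by rewrite !mul0r.
apply: (@reduce_quadratic M 0 a) => S.
by rewrite subr0 M_mulX.
Qed.

(** Reduction of [N] at [x = 1]; since [N_mulX1] concerns [1 - 'X] and not ['X - 1], the constant is
    [- b]. For [n = 0] both sides vanish, so the truncated [n.-1] is harmless. *)
Lemma auxr_quadratic1 n :
  (auxr n + n%:R) * (auxr n + n%:R + b) =
  rec_b n * ((auxR n - l) * (auxR n.-1 - l)).
Proof.
case: n => [|n]; first by rewrite /= !mul0r addr0 mul0r.
rewrite -!N_sqr_quotient -N_succ_quotient -[b]opprK.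
apply: (@reduce_quadratic N 1 (- b)) => S.
by rewrite -opprB mulNr linearN N_mulX1 mulNr.
Qed.

(** Substitute the recurrence for [P n.+1] in [M (P n.+1 * P n)]. The last term yields [auxr n]
    because [rec_b n / sqnorm n] is the inverse of the preceding norm. *)
Lemma auxr_succ n : auxr n.+1 + auxr n = a - rec_a n * auxR n.
Proof.
have h0 := sqnorm_neq0 n.
have -> : auxr n.+1 = a - rec_a n * auxR n
   - rec_b n * M (prevP n * P n) / sqnorm n.
  rewrite /auxr three_term !mulrBl !linearB/= -!scalerAl -['X * _ * _]mulrA M_mulX.
  by rewrite ![M (_ *: (_ * _))]linearZ/= -/(sqnorm n) /auxR; field.
case: n h0 => [|n] h0 /=; first by rewrite !mul0r; ring.
have h1 := sqnorm_neq0 n.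
by rewrite [P n * _]mulrC; field; rewrite h0 h1.
Qed.

End LadderIdentities.

End OrthogonalPolynomials.

Arguments sqnorm {F} L P n.
Arguments prevP {F} P n.
Arguments rec_a {F} L P n.
Arguments rec_b {F} L P n.
Arguments sublead {F} P n.
Arguments auxR {F} L P M n.
Arguments auxr {F} L P M n.

(** * Elimination in the Riccati system *)

(** [X1] and [r1] are the right sides of the first order system and [X2] is the derivative of the
    first one. Since [r] enters [X1] linearly, [X1] can stand for [r]; the claim is then an identity
    of rational functions. *)
Lemma Rn_second_order (F : fieldType) (a b N l X r X1 r1 X2 : F) :
  l != 0 -> X != 0 -> X - l != 0 -> (2 : F) != 0 ->
  X1 = 2 * r - a + (2 * N + 1 + a + b + l - X) * X / l ->
  r1 = (r ^+ 2 - a * r) / X - (r ^+ 2 - a * r) / l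
    + X * ((r + N) * (r + N + b)) / (X - l) / l ->
  X2 = 2 * r1 + ((1 - X1) * X + (2 * N + 1 + a + b + l - X) * X1) / l
    - (2 * N + 1 + a + b + l - X) * X / l ^+ 2 ->
  X2 = 1 / (2 * l ^+ 2 * (X - l) * X) *
        ((2 * X - l) * (l * X1) ^+ 2 - 2 * l * X ^+ 2 * X1 + 2 * X ^+ 5
         - 2 * a ^+ 2 * l ^+ 2 * X + a ^+ 2 * l ^+ 3
         - (2 * (2 * N + 1 + a + b) + 5 * l) * X ^+ 4
         + 4 * l * (2 * N + 1 + a + b + l) * X ^+ 3
         - (l ^+ 3 - l * (1 + a ^+ 2 - b ^+ 2)
            + 2 * l ^+ 2 * (2 * N + 1 + a + b)) * X ^+ 2).
Proof.
move=> l0 X0 Xl two -> -> ->.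
field.
by rewrite l0 X0 Xl two.
Qed.

(* The hypothesis on [r2] is the derivative in [l] of [l r1 = B T - A / T], where
   [A = r (r - a)], [B = (r + N) (r + N + b)] and [T = X / (X - l)]. The squares
   come from [4 A B + (l r1)^2 = (B T + A / T)^2]. *)
Lemma rn_second_order (F : fieldType) (a b N l X r X1 r1 r2 : F) :
  l != 0 -> X != 0 -> X - l != 0 ->
  X1 = 2 * r - a + (2 * N + 1 + a + b + l - X) * X / l ->
  r1 = (r ^+ 2 - a * r) / X - (r ^+ 2 - a * r) / l
    + X * ((r + N) * (r + N + b)) / (X - l) / l ->
  r1 + l * r2 = (2 * r + 2 * N + b) * r1 * (X / (X - l))
     - (2 * r - a) * r1 / (X / (X - l))
     + ((r + N) * (r + N + b) + (r ^+ 2 - a * r) / (X / (X - l)) ^+ 2)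
       * (X1 / (X - l) - X * (X1 - 1) / (X - l) ^+ 2) ->
  (l ^+ 2 * r2 + 8 * r ^+ 3 + 6 * (2 * N - a + b) * r ^+ 2
       + 4 * (N ^+ 2 - 2 * N * a + N * b - a * b) * r
       - 2 * N * (N + b) * a + l * r1) ^+ 2
      = (4 * r + l + 2 * N - a + b) ^+ 2
        * (4 * r * (r - a) * (r + N) * (r + N + b) + (l * r1) ^+ 2).
Proof.
move=> l0 X0 Xl e1 e2 e3.
have -> : 4 * r * (r - a) * (r + N) * (r + N + b) + (l * r1) ^+ 2 =
  ((r + N) * (r + N + b) * (X / (X - l)) + r * (r - a) / (X / (X - l))) ^+ 2.
  by rewrite e2; field; rewrite l0 X0 Xl.
have -> : l ^+ 2 * r2 = l * (r1 + l * r2) - l * r1 by ring.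
rewrite e3 -exprMn.
by congr (_ ^+ 2); rewrite e1 e2; field; rewrite l0 X0 Xl.
Qed.

(** * Integration with endpoint singularities *)

Section OpenIntervalFTC.
Local Open Scope classical_set_scope.
Local Open Scope ring_scope.
Context {R : realType}.
Local Notation mu := (@lebesgue_measure R).
Variables f F : R -> R.
Hypothesis dF : forall x : R, x \in `]0, 1[ -> is_derive x 1 F (f x).
Hypothesis cF : {within `[0, 1], continuous F}.
Hypothesis cf : forall x : R, x \in `]0, 1[ -> {for x, continuous f}.

(** Here [f] may blow up at the endpoints. The indefinite integral [G] and [F] are continuous on the
    closed interval with the same derivative inside, so the mean value theorem makes [G - F]
    constant. *)
Lemma FTC2_integrable : mu.-integrable `[0, 1] (EFin \o f) ->
  \int[mu]_(x in `[0, 1]) f x = F 1 - F 0.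
Proof.
move=> intf; pose G x := \int[mu]_(t in `[0, x]) f t.
have cG : {within `[0, 1], continuous G}.
  exact: parameterized_integral_continuous.
have dG (x : R) : x \in `]0, 1[ -> is_derive x 1 G (f x).
  move=> x01; have := x01; rewrite in_itv/= => /andP[x0 x1].
  have [dGx GE] := continuous_FTC1_closed x1 intf x0 (cf x01).
  by apply: DeriveDef => //; rewrite -derive1E.
have [x x01|x|c _] := @MVT_segment R (G \- F) (fun=> 0) 0 1 ler01.
- by apply: is_derive_eq (subrr (f x)); apply: is_deriveB; [exact: dG|exact: dF].
- by apply: continuousB; [exact: cG|exact: cF].
have G0 : G 0 = 0 by rewrite /G set_itv1 Rintegral_set1.
by rewrite mul0r /= G0 -/(G 1) => GF; lra.
Qed.

(** On compact subintervals the integral of [f] is an increment of [F], hence at most the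
    oscillation of [F]; monotone convergence carries this bound to the open interval. *)
Lemma derive_ge0_integrable : measurable_fun [set: R] f ->
  (forall x : R, x \in `]0, 1[ -> 0 <= f x) ->
  mu.-integrable `[0, 1] (EFin \o f).
Proof.
move=> mf f0.
have mfD (D : set R) : measurable_fun D (fun x => (f x)%:E).
  by apply/measurable_EFinP; exact: measurable_funTS.
have mafD (D : set R) : measurable_fun D (fun x => `|(f x)%:E|%E).
  by apply: measurableT_comp => //; exact: mfD.
have [M _ FM] := EVT_max ler01 cF; have [m _ Fm] := EVT_min ler01 cF.
(* Starting at 1/3 keeps [e n] below one half, so each interval [I n] is nondegenerate. *)
pose e (n : nat) : R := n.+3%:R^-1.
have e0 n : 0 < e n by rewrite invr_gt0.
have e2 n : e n < 1 - e n.
  rewrite ltrBrDr -mulr2n -mulr_natr mulrC ltr_pdivrMr//.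
  by rewrite mul1r ltr_nat.
have e1 n : 1 - e n < 1 by rewrite ltrBlDr ltrDl.
pose I n : set R := `[e n, 1 - e n]%classic.
have I01 n (x : R) : x \in `[e n, 1 - e n] -> x \in `]0, 1[.
  rewrite !in_itv/= => /andP[ex xe].
  by rewrite (lt_le_trans (e0 n) ex) (le_lt_trans xe (e1 n)).
have intI n : (\int[mu]_(x in I n) (EFin \o f) x <= (F M - F m)%:E)%E.
  have dFI (x : R) : x \in `[e n, 1 - e n] -> is_derive x 1 F (f x).
    by move/I01; exact: dF.
  have cFI : {within `[e n, 1 - e n], continuous F}.
    by apply: derivable_within_continuous => x /dFI [].
  rewrite /I (@continuous_FTC2 R f F _ _ (e2 n)).
  - rewrite -EFinB lee_fin lerB//.
      by apply: FM; rewrite in_itv/= (ltW (e1 n)) (le_trans (ltW (e0 n)) (ltW (e2 n))).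
    by apply: Fm; rewrite in_itv/= (ltW (e0 n)) (le_trans (ltW (e2 n)) (ltW (e1 n))).
  - apply: continuous_in_subspaceT => x; rewrite inE/= => /I01; exact: cf.
  - have /(continuous_within_itvP _ (e2 n))[_ ? ?] := cFI; split => // x.
    by move=> /subset_itv_oo_cc /dFI [].
  - by move=> x /subset_itv_oo_cc /dFI [_ <-]; rewrite derive1E.
have IU : \bigcup_n I n = `]0, 1[%classic.
  apply/seteqP; split => [x [n _ /=]|x /=]; first by move=> /I01.
  rewrite in_itv/= => /andP[x0 x1].
  pose d := Num.min x (1 - x).
  have d0 : 0 < d by rewrite lt_min x0 subr_gt0.
  have [n nd] : exists n, e n < d.
    exists (Num.truncn d^-1); rewrite /e invf_plt ?posrE//.
    by rewrite (lt_trans (truncnS_gt _))// ltr_nat.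
  exists n => //; rewrite /I /= in_itv/=.
  move: nd; rewrite lt_min => /andP[/ltW -> /ltW]; lra.
apply/integrableP; split; first exact: mfD.
(* The endpoints are null; dropping them leaves the union of the [I n], where [f] is known to be
   nonnegative. *)
rewrite -integral_itv_bndo_bndc; last exact: mafD.
rewrite -integral_itv_obnd_cbnd; last exact: mafD.
have -> : (\int[mu]_(x in `]0%R, 1%R[) `|(EFin \o f) x| =
    \int[mu]_(x in `]0%R, 1%R[) (EFin \o f) x)%E.
  by apply: eq_integral => x; rewrite inE/= => x01; rewrite ger0_norm ?f0.
rewrite -IU.
have nI : nondecreasing_seq I.
  apply/nondecreasing_seqP => n; rewrite subsetEset => x.
  have en : e n.+1 <= e n by rewrite lef_pV2 ?posrE// ler_nat.
  rewrite /I /= !in_itv/=; lra.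
have cI : (\int[mu]_(x in I n) (EFin \o f) x)%E @[n --> \oo] -->
    (\int[mu]_(x in \bigcup_n I n) (EFin \o f) x)%E.
  apply: ge0_nondecreasing_set_cvg_integral => //.
  - by move=> n; exact: measurable_itv.
  - by move=> n; exact: mfD.
  - by move=> n x /I01 x01; rewrite lee_fin f0.
rewrite -(cvg_lim _ cI)//; apply: (@le_lt_trans _ _ (F M - F m)%:E).
  apply: lime_le; first by apply/cvg_ex; eexists; exact: cI.
  by apply: nearW => n; exact: intI.
by rewrite ltry.
Qed.

End OpenIntervalFTC.

(** * Powers of x and 1 - x on the unit interval *)

Section PowerFunctions.
Local Open Scope classical_set_scope.
Local Open Scope ring_scope.
Context {R : realType}.
Local Notation mu := (@lebesgue_measure R).
Implicit Types a x : R.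

Lemma is_derive_cvg (f : R -> R) (x df : R) :
  is_derive x 1 f df -> f z @[z --> x] --> f x.
Proof.
by move=> [? _]; apply: differentiable_continuous; exact/derivable1_diffP.
Qed.

Lemma within_continuousM (D : set R) (g h : R -> R) :
  {within D, continuous g} -> {within D, continuous h} ->
  {within D, continuous (fun y => g y * h y)}.
Proof. by move=> cg ch x; exact: cvgM (cg x) (ch x). Qed.

Lemma is_derive_powR_onem a x : x < 1 ->
  is_derive x 1 (fun y => (1 - y) `^ a) (- (a * (1 - x) `^ (a - 1))).
Proof.
move=> x1; have x1' : 0 < 1 - x by rewrite subr_gt0.
have d1 : is_derive x 1 (fun y : R => 1 - y) (0 - 1).
  exact: is_deriveB.
have := @is_derive1_comp _ (@powR R ^~ a) (fun y => 1 - y) x _ _ (is_derive1_powR a x1') d1.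
by rewrite sub0r mulrN1.
Qed.

Lemma powR_onem_cvg0 a : 0 < a -> (1 - x) `^ a @[x --> 1^'-] --> (0 : R).
Proof.
move=> a0; apply/cvgrPdist_le => e e0.
have /cvgrPdist_le/(_ e e0)[d d0 Hd] := powR_cvg0 a0.
exists d => // y /= yd y1; apply: Hd; last by rewrite subr_gt0.
by rewrite /ball_/= sub0r opprB distrC.
Qed.

Lemma powR_le1 a x : 0 < a -> 0 <= x <= 1 -> x `^ a <= 1.
Proof.
move=> a0 /andP[x0 x1]; have /= := @ge0_ler_powR R a (ltW a0) x 1.
by rewrite powR1; apply; rewrite ?nnegrE.
Qed.

Lemma within_continuous_powR a : 0 < a ->
  {within `[0, 1], continuous (@powR R ^~ a)}.
Proof.
move=> a0; apply/(continuous_within_itvP _ ltr01); split.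
- move=> x; rewrite in_itv/= => /andP[x0 _].
  exact: (is_derive_cvg (is_derive1_powR a x0)).
- by rewrite powR0 ?gt_eqF//; exact: powR_cvg0.
- by apply/cvg_at_left_filter/(is_derive_cvg (is_derive1_powR a ltr01)).
Qed.

Lemma within_continuous_powR_onem a : 0 < a ->
  {within `[0, 1], continuous (fun x : R => (1 - x) `^ a)}.
Proof.
move=> a0; apply/(continuous_within_itvP _ ltr01); split.
- move=> x; rewrite in_itv/= => /andP[_ x1].
  exact: (is_derive_cvg (is_derive_powR_onem a x1)).
- by apply/cvg_at_right_filter/(is_derive_cvg (is_derive_powR_onem a ltr01)).
- by rewrite subrr powR0 ?gt_eqF//; exact: powR_onem_cvg0.
Qed.

Lemma measurable_powR_onem a : measurable_fun [set: R] (fun x => (1 - x) `^ a).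
Proof.
apply: (@measurableT_comp _ _ _ _ _ _ (@powR R ^~ a)); first exact: measurable_powR.
exact: measurable_funB.
Qed.

(** The exponent [a - 1] may be negative, but the integrand is the nonnegative derivative of a
    function continuous up to [0]. Multiples of it dominate the integrands with a factor [1 / x]. *)
Lemma integrable_powR a : 0 < a ->
  mu.-integrable `[0, 1] (EFin \o (fun x => a * x `^ (a - 1))).
Proof.
move=> a0; apply: (@derive_ge0_integrable R _ (@powR R ^~ a)).
- by move=> x; rewrite in_itv/= => /andP[x0 _]; exact: is_derive1_powR.
- exact: within_continuous_powR.
- move=> x; rewrite in_itv/= => /andP[x0 _].
  apply: cvgM; first exact: cvg_cst.
  exact: (is_derive_cvg (is_derive1_powR (a - 1) x0)).
- by apply: measurable_funM => //; exact: measurable_powR.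
- by move=> x _; rewrite mulr_ge0 ?powR_ge0 ?ltW.
Qed.

Lemma integrable_powR_onem a : 0 < a ->
  mu.-integrable `[0, 1] (EFin \o (fun x => a * (1 - x) `^ (a - 1))).
Proof.
move=> a0; apply: (@derive_ge0_integrable R _ (fun x => - (1 - x) `^ a)).
- move=> x; rewrite in_itv/= => /andP[_ x1].
  by have := is_deriveN (is_derive_powR_onem a x1); rewrite opprK.
- by move=> x; have H := @within_continuous_powR_onem a a0 x; apply: cvgN; exact: H.
- move=> x; rewrite in_itv/= => /andP[_ x1].
  apply: cvgM; first exact: cvg_cst.
  exact: (is_derive_cvg (is_derive_powR_onem (a - 1) x1)).
- by apply: measurable_funM => //; exact: measurable_powR_onem.
- by move=> x _; rewrite mulr_ge0 ?powR_ge0 ?ltW.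
Qed.

End PowerFunctions.

(** * Integrals against the weight *)

Section WeightIntegrals.
Local Open Scope classical_set_scope.
Local Open Scope ring_scope.
Context {R : realType} {alpha beta : R} (l : R).
Hypotheses (alpha_gt0 : 0 < alpha) (beta_gt0 : 0 < beta).
Local Notation mu := (@lebesgue_measure R).
Local Notation w := (weight alpha beta l).

Lemma weight_ge0 x : 0 <= w x.
Proof. by rewrite /weight !mulr_ge0 ?powR_ge0 ?expR_ge0. Qed.

Lemma weight_gt0 x : 0 < x < 1 -> 0 < w x.
Proof.
by move=> /andP[x0 x1]; rewrite /weight !mulr_gt0 ?powR_gt0 ?expR_gt0 ?subr_gt0.
Qed.

Lemma measurable_weight : measurable_fun [set: R] w.
Proof.
apply: measurable_funM.
  by apply: measurable_funM; [exact: measurable_powR|exact: measurable_powR_onem].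
by apply: measurableT_comp => //; apply: measurableT_comp.
Qed.

(** Each bound keeps one power and estimates the other by [1]: the first absorbs a division by [x],
    the second a division by [1 - x]. *)
Lemma weight_le x : 0 <= x <= 1 ->
  w x <= x `^ alpha * expR `|l| /\ w x <= (1 - x) `^ beta * expR `|l|.
Proof.
move=> /andP[x0 x1]; have x1' : 0 <= 1 - x by rewrite subr_ge0.
have e1 : expR (- (l * x)) <= expR `|l|.
  rewrite ler_expR (le_trans (ler_norm _))// normrN normrM (ger0_norm x0).
  by rewrite ler_piMr.
rewrite /weight; split; apply: ler_pM => //; rewrite ?mulr_ge0 ?powR_ge0 ?expR_ge0//.
  by rewrite ler_piMr ?powR_ge0// powR_le1// x1' lerBlDr lerDl.
by rewrite ler_piMl ?powR_ge0// powR_le1// x0.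
Qed.

Lemma measurable_horner (p : {poly R}) : measurable_fun [set: R] (horner p).
Proof. by apply: continuous_measurable_fun; exact: continuous_horner. Qed.

Lemma horner_bounded (p : {poly R}) :
  exists C, forall x, 0 <= x <= 1 -> `|p.[x]| <= C.
Proof.
have cp : {within `[0, 1], continuous (fun x => `|p.[x]|)}.
  apply: continuous_subspaceT => x; apply: cvg_norm; exact: continuous_horner.
have [c _ pc] := EVT_max ler01 cp.
by exists `|p.[c]| => x x01; apply: pc; rewrite in_itv.
Qed.

(** The division by [1] gives this the same shape as the two integrands with poles that follow. *)
Lemma integrable_horner_weight (p : {poly R}) :
  mu.-integrable `[0, 1] (EFin \o (fun x => p.[x] / 1 * w x)).
Proof.
have [C pC] := horner_bounded p.
apply: measurable_bounded_integrable => //.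
- by rewrite /= lebesgue_measure_itv/= lte_fin ltr01 -EFinD ltry.
- apply: measurable_funTS; apply: measurable_funM; last exact: measurable_weight.
  by apply: measurable_funM => //; exact: measurable_horner.
- exists (C * expR `|l|); split; first exact: num_real.
  move=> M CM x /=; rewrite in_itv/= => x01; apply: (le_trans _ (ltW CM)).
  rewrite divr1 normrM (ger0_norm (weight_ge0 _)).
  apply: ler_pM; rewrite ?normr_ge0 ?weight_ge0//; first exact: pC.
  have [wx _] := weight_le x01; rewrite (le_trans wx)// ler_piMl ?expR_ge0//.
  exact: powR_le1.
Qed.

Lemma integrable_horner_weight_div (p : {poly R}) :
  mu.-integrable `[0, 1] (EFin \o (fun x => p.[x] / x * w x)).
Proof.
have [C pC] := horner_bounded p.
have C0 : 0 <= C by apply: le_trans (pC 0 _); rewrite ?normr_ge0// lexx ler01.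
have a0 := gt_eqF alpha_gt0.
(* The dominating function is [C * expR |l|] times the power [alpha - 1] of [x]; dividing by [alpha]
   cancels the factor present in [integrable_powR]. *)
have := @integrableZl _ _ _ mu _ (measurable_itv `[0, 1])
  (C * expR `|l| / alpha) _ (integrable_powR alpha_gt0).
apply: le_integrable => //.
  apply/measurable_EFinP.
  (* [x^-1] is traded for [x `^ (-1)], which is known to be measurable. *)
  apply: (@eq_measurable_fun _ _ _ _ _ (fun x => p.[x] * x `^ (-1) * w x)).
    by move=> x; rewrite inE/= in_itv/= => /andP[x0 _]; rewrite powR_inv1.
  apply: measurable_funTS; apply: measurable_funM; last exact: measurable_weight.
  by apply: measurable_funM; [exact: measurable_horner|exact: measurable_powR].
move=> x /=; rewrite in_itv/= => x01; rewrite lee_fin.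
have /andP[] := x01; rewrite le_eqVlt => /predU1P[<- _|x0 x1].
  by rewrite invr0 mulr0 mul0r normr0 normr_ge0.
have -> : C * expR `|l| / alpha * (alpha * x `^ (alpha - 1)) =
    C * (expR `|l| * x `^ (alpha - 1)) by field; rewrite a0.
rewrite -mulrA normrM [`|_^-1 * _|]normrM [`|C * _|]normrM [`|expR _ * _|]normrM.
rewrite (ger0_norm C0) (ger0_norm (weight_ge0 _)).
rewrite (ger0_norm (expR_ge0 _)) (ger0_norm (powR_ge0 _ _)).
apply: ler_pM => //; [|exact: pC|].
  by apply: mulr_ge0 => //; exact: weight_ge0.
rewrite gtr0_norm ?invr_gt0// ler_pdivrMl// mulrCA (mulr_powRB1 (ltW x0))//.
by have [+ _] := weight_le x01; rewrite mulrC.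
Qed.

Lemma integrable_horner_weight_div_onem (p : {poly R}) :
  mu.-integrable `[0, 1] (EFin \o (fun x => p.[x] / (1 - x) * w x)).
Proof.
have [C pC] := horner_bounded p.
have C0 : 0 <= C by apply: le_trans (pC 0 _); rewrite ?normr_ge0// lexx ler01.
have b0 := gt_eqF beta_gt0.
have := @integrableZl _ _ _ mu _ (measurable_itv `[0, 1])
  (C * expR `|l| / beta) _ (integrable_powR_onem beta_gt0).
apply: le_integrable => //.
  apply/measurable_EFinP.
  apply: (@eq_measurable_fun _ _ _ _ _ (fun x => p.[x] * (1 - x) `^ (-1) * w x)).
    move=> x; rewrite inE/= in_itv/= => /andP[_ x1].
    by rewrite powR_inv1// subr_ge0.
  apply: measurable_funTS; apply: measurable_funM; last exact: measurable_weight.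
  by apply: measurable_funM; [exact: measurable_horner|exact: measurable_powR_onem].
move=> x /=; rewrite in_itv/= => x01; rewrite lee_fin.
have /andP[x0] := x01; rewrite le_eqVlt => /predU1P[->|x1].
  by rewrite subrr invr0 mulr0 mul0r normr0 normr_ge0.
have -> : C * expR `|l| / beta * (beta * (1 - x) `^ (beta - 1)) =
    C * (expR `|l| * (1 - x) `^ (beta - 1)) by field; rewrite b0.
rewrite -mulrA normrM [`|_^-1 * _|]normrM [`|C * _|]normrM [`|expR _ * _|]normrM.
rewrite (ger0_norm C0) (ger0_norm (weight_ge0 _)).
rewrite (ger0_norm (expR_ge0 _)) (ger0_norm (powR_ge0 _ _)).
apply: ler_pM => //; [|exact: pC|].
  by apply: mulr_ge0 => //; exact: weight_ge0.
rewrite gtr0_norm ?invr_gt0 ?subr_gt0// ler_pdivrMl ?subr_gt0// mulrCA.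
have x1' : 0 <= 1 - x by rewrite subr_ge0 ltW.
rewrite (mulr_powRB1 x1')//.
by have [_ +] := weight_le x01; rewrite mulrC.
Qed.

End WeightIntegrals.

(** * Linear functionals defined by the weight *)

Section WeightFunctionals.
Local Open Scope classical_set_scope.
Local Open Scope ring_scope.
Context {R : realType} (alpha beta l : R).
Hypotheses (alpha_gt0 : 0 < alpha) (beta_gt0 : 0 < beta).
Local Notation mu := (@lebesgue_measure R).
Local Notation w := (weight alpha beta l).

(* Used for [k = 1], [x] and [1 - x]; the last two vanish at an endpoint, where
   the quotient is [0] and so is the weight. *)
Definition wfun (k : R -> R) (p : {poly R}) : R :=
  wint w (fun x => p.[x] / k x).

Section LinearPositive.
Variable k : R -> R.
Hypothesis k_int : forall p : {poly R},
  mu.-integrable `[0, 1] (EFin \o (fun x => p.[x] / k x * w x)).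

Lemma wfun_is_linear : scalar (wfun k).
Proof.
move=> a p q; rewrite /wfun /wint -RintegralZl// -RintegralD//.
  by apply: eq_Rintegral => x _; rewrite hornerD hornerZ; ring.
exact: integrableZl (k_int p).
Qed.

Definition scaled_wfun (c : R) (p : {poly R}) := c * wfun k p.

Lemma scaled_wfun_is_linear c : scalar (scaled_wfun c).
Proof. by move=> a p q; rewrite /scaled_wfun wfun_is_linear; ring. Qed.

Definition wfun_scalar c : {scalar {poly R}} :=
  HB.pack (scaled_wfun c)
    (GRing.isLinear.Build R {poly R} R *%R (scaled_wfun c)
       (scaled_wfun_is_linear c)).

(** The integrand is nonnegative, the weight being zero at both endpoints. Were the integral zero,
    the integrand would vanish almost everywhere, and the open interval, of measure one, would lie
    in a null set together with the finitely many roots of [p]. *)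
Lemma wfun_sqr_gt0 (p : {poly R}) :
  (forall x, 0 < x < 1 -> 0 < k x) -> p != 0 -> 0 < wfun k (p * p).
Proof.
move=> k0 p0.
have pk0 x : x \in `[0, 1] -> 0 <= (p * p).[x] / k x * w x.
  rewrite in_itv/= => /andP[x0 x1].
  have [->|xn0] := eqVneq x 0; first by rewrite /weight powR0 ?gt_eqF// !mul0r mulr0.
  have [->|xn1] := eqVneq x 1.
    by rewrite /weight subrr powR0 ?gt_eqF// mulr0 !mul0r mulr0.
  have x01 : 0 < x < 1 by rewrite !lt_neqAle x0 x1 xn1 eq_sym xn0.
  rewrite mulr_ge0 ?weight_ge0// divr_ge0//; last by rewrite ltW// k0.
  by rewrite hornerM -expr2 sqr_ge0.
rewrite lt_def Rintegral_ge0// andbT; apply/negP => /eqP int0.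
have [N [mN N0 subN]] :
    ae_eq mu `[0, 1]%classic (EFin \o (fun x => (p * p).[x] / k x * w x)) (cst 0%E).
  apply/ae_eq_integral_abs => //; first exact: measurable_int (k_int _).
  rewrite -[LHS]fineK; last first.
    exact: integrable_fin_num (integrable_abse (k_int _)).
  rewrite -[RHS]/(0%R%:E) -[in RHS]int0 /wfun /wint /Rintegral; congr (fine _)%:E.
  by apply: eq_integral => x; rewrite inE/= => x01; rewrite /= ger0_norm// pk0.
have finroots : finite_set [set x | root p x].
  apply: contrapT => /(@infinite_set_fset _ _ (size p))[B Bp].
  apply/negP; rewrite -ltnNge; apply: max_poly_roots => //.
    by apply/allP => x xB; exact: Bp.
  exact: finmap.fset_uniq.
have : (mu `]0%R, 1%R[%classic <= mu (N `|` [set x | root p x]))%E.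
  apply: le_measure; rewrite ?inE//.
    by apply: measurableU => //; exact: countable_measurable (finite_set_countable finroots).
  move=> x; rewrite /= in_itv/= => x01; have /andP[x0 x1] := x01.
  have [rx|nrx] := boolP (root p x); [by right|left; apply: subN].
  apply/not_implyP; split => /=; first by rewrite in_itv/= !ltW.
  move=> [] /eqP; apply/negP; apply: mulf_neq0; last by rewrite gt_eqF// weight_gt0.
  by apply: mulf_neq0; [rewrite hornerM mulf_neq0|rewrite invr_neq0// gt_eqF// k0].
rewrite lebesgue_measure_itv/= lte_fin ltr01 oppr0 adde0 measureU0//.
- by rewrite [X in (_ <= X)%E]N0 lee_fin ler10.
- exact: countable_measurable (finite_set_countable finroots).
- exact: countable_lebesgue_measure0 (finite_set_countable finroots).
Qed.

End LinearPositive.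

Lemma is_derive_weight (x : R) : 0 < x < 1 ->
  is_derive x 1 w ((alpha / x - beta / (1 - x) - l) * w x).
Proof.
move=> /andP[x0 x1]; have x1' : 0 < 1 - x by rewrite subr_gt0.
have dexp : is_derive x 1 (fun y : R => expR (- (l * y))) (expR (- (l * x)) * (- l)).
  apply: (@is_derive1_comp _ expR (fun y => - (l * y))).
  have -> : (fun y => - (l * y)) = horner (- l *: 'X).
    by apply/funext => y; rewrite hornerZ hornerX mulNr.
  by apply: is_derive_eq; rewrite derivZ derivX !hornerE.
have dw := is_deriveM (is_deriveM (is_derive1_powR alpha x0)
  (is_derive_powR_onem beta x1)) dexp.
apply: (@is_derive_eq _ _ _ w _ _ _ _ dw); rewrite /weight mulrfctE /=.
rewrite -(mulr_powRB1 (ltW x0) alpha_gt0) -(mulr_powRB1 (ltW x1') beta_gt0).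
rewrite /GRing.scale/=.
have [x0' x1''] := (gt_eqF x0, gt_eqF x1').
by field; rewrite x0' x1''.
Qed.

(** The derivative of [p] times the weight is integrated over the interval. It may be unbounded at
    the endpoints when an exponent is below [1], hence the use of [FTC2_integrable]; the boundary
    values vanish because both exponents are positive. *)
Lemma wfun_pearson (p : {poly R}) :
  wfun (cst 1) p^`() + alpha * wfun id p - beta * wfun (fun x => 1 - x) p =
  l * wfun (cst 1) p.
Proof.
have i1 := @integrable_horner_weight R alpha beta l alpha_gt0 beta_gt0.
have ix := @integrable_horner_weight_div R alpha beta l alpha_gt0 beta_gt0.
have iy := @integrable_horner_weight_div_onem R alpha beta l alpha_gt0 beta_gt0.
pose f (x : R) := p^`().[x] / 1 * w x + alpha * (p.[x] / x * w x)
   - beta * (p.[x] / (1 - x) * w x) - l * (p.[x] / 1 * w x).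
have dF (x : R) : x \in `]0, 1[ -> is_derive x 1 (fun y => p.[y] * w y) (f x).
  rewrite in_itv/= => x01; have /andP[x0 x1] := x01.
  have dpw := is_deriveM (is_derive_poly p x) (is_derive_weight x01).
  apply: (@is_derive_eq _ _ _ (fun y => p.[y] * w y) _ _ _ _ dpw).
  by rewrite /f !divr1 /GRing.scale/=; ring.
have cF : {within `[0, 1], continuous (fun y => p.[y] * w y)}.
  apply: within_continuousM; first exact: continuous_subspaceT (@continuous_horner R p).
  apply: within_continuousM.
    apply: within_continuousM; first exact: within_continuous_powR.
    exact: within_continuous_powR_onem.
  apply: continuous_subspaceT => z; apply: continuous_comp; last exact: continuous_expR.
  by apply: cvgN; apply: cvgM; [exact: cvg_cst|exact: cvg_id].
have cf (x : R) : x \in `]0, 1[ -> {for x, continuous f}.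
  rewrite in_itv/= => x01; have /andP[x0 x1] := x01.
  have cw : w z @[z --> x] --> w x := is_derive_cvg (is_derive_weight x01).
  have cp (q : {poly R}) : q.[z] @[z --> x] --> q.[x] by exact: continuous_horner.
  apply: cvgB.
    apply: cvgB.
      apply: cvgD.
        by apply: cvgM => //; apply: cvgM => //; exact: cvg_cst.
      apply: cvgM; first exact: cvg_cst.
      apply: cvgM => //; apply: cvgM => //.
      by apply: cvgV; [rewrite gt_eqF|exact: cvg_id].
    apply: cvgM; first exact: cvg_cst.
    apply: cvgM => //; apply: cvgM => //.
    apply: cvgV; first by rewrite gt_eqF ?subr_gt0.
    by apply: cvgB; [exact: cvg_cst|exact: cvg_id].
  apply: cvgM; first exact: cvg_cst.
  by apply: cvgM => //; apply: cvgM => //; exact: cvg_cst.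
have Zint (c : R) (h : R -> R) : mu.-integrable `[0, 1] (EFin \o h) ->
    mu.-integrable `[0, 1] (EFin \o (fun x : R => c * h x)).
  by move=> ih; exact: (@integrableZl _ _ _ mu _ (measurable_itv `[0, 1]) c _ ih).
have Dint (g h : R -> R) : mu.-integrable `[0, 1] (EFin \o g) ->
    mu.-integrable `[0, 1] (EFin \o h) ->
    mu.-integrable `[0, 1] (EFin \o (fun x : R => g x + h x)).
  by move=> ig ih; exact: (@integrableD _ _ _ mu _ (measurable_itv `[0, 1]) _ _ ig ih).
have Bint (g h : R -> R) : mu.-integrable `[0, 1] (EFin \o g) ->
    mu.-integrable `[0, 1] (EFin \o h) ->
    mu.-integrable `[0, 1] (EFin \o (fun x : R => g x - h x)).
  by move=> ig ih; exact: (@integrableB _ _ _ mu _ (measurable_itv `[0, 1]) _ _ ig ih).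
have i12 := Dint _ _ (i1 p^`()) (Zint alpha _ (ix p)).
have i123 := Bint _ _ i12 (Zint beta _ (iy p)).
have intf := Bint _ _ i123 (Zint l _ (i1 p)).
have := FTC2_integrable dF cF cf intf.
rewrite /weight powR0 ?gt_eqF// subrr powR0 ?gt_eqF//.
rewrite !(mul0r, mulr0, subrr) => /eqP; rewrite /f.
rewrite (@RintegralB _ _ _ mu _ _ _ _ i123 (Zint l _ (i1 p)))//.
rewrite (@RintegralB _ _ _ mu _ _ _ _ i12 (Zint beta _ (iy p)))//.
rewrite (@RintegralD _ _ _ mu _ _ _ _ (i1 p^`()) (Zint alpha _ (ix p)))//.
by rewrite !RintegralZl// subr_eq0 => /eqP.
Qed.

Lemma wfun_mulX (p : {poly R}) : wfun id ('X * p) = wfun (cst 1) p.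
Proof.
apply: eq_Rintegral => x; rewrite inE/= in_itv/= => /andP[].
rewrite le_eqVlt => /predU1P[<- _|x0 _].
  by rewrite /weight powR0 ?gt_eqF// !mul0r !mulr0.
by rewrite hornerM hornerX [x * _]mulrC mulfK ?gt_eqF// divr1.
Qed.

Lemma wfun_mul_onemX (p : {poly R}) :
  wfun (fun x => 1 - x) ((1 - 'X) * p) = wfun (cst 1) p.
Proof.
apply: eq_Rintegral => x; rewrite inE/= in_itv/= => /andP[_].
rewrite le_eqVlt => /predU1P[->|x1].
  by rewrite /weight subrr powR0 ?gt_eqF// !(mul0r, mulr0).
rewrite hornerM !hornerE [(1 - x) * _]mulrC mulfK ?divr1//.
by rewrite gt_eqF// subr_gt0.
Qed.

End WeightFunctionals.

(** * Differentiation under the integral sign *)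

Section ParameterDerivative.
Local Open Scope classical_set_scope.
Local Open Scope ring_scope.
Context {R : realType} (alpha beta : R).
Hypotheses (alpha_gt0 : 0 < alpha) (beta_gt0 : 0 < beta).
Local Notation mu := (@lebesgue_measure R).

Lemma is_derive_weight_param (x t : R) :
  is_derive t 1 (fun l => weight alpha beta l x) (- (x * weight alpha beta t x)).
Proof.
have dl : is_derive t 1 (fun l : R => expR (- (l * x))) (expR (- (t * x)) * (- x)).
  apply: (@is_derive1_comp _ expR (fun l => - (l * x))).
  have -> : (fun l => - (l * x)) = horner (- x *: 'X).
    by apply/funext => y; rewrite hornerZ hornerX mulNr mulrC.
  by apply: is_derive_eq; rewrite derivZ derivX !hornerE.
have dw := is_deriveM (is_derive_cst (x `^ alpha * (1 - x) `^ beta) t (1 : R)) dl.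
apply: (@is_derive_eq _ _ _ (fun l => weight alpha beta l x) _ _ _ _ dw).
by rewrite /weight /GRing.scale/=; ring.
Qed.

Lemma is_derive_wfun_param (p : {poly R}) (t : R) :
  is_derive t 1 (fun l => wfun alpha beta l (cst 1) p)
    (- wfun alpha beta t (cst 1) ('X * p)).
Proof.
pose f l x := p.[x] / 1 * weight alpha beta l x.
have df (l x : R) : is_derive l 1 (f ^~ x) (- (('X * p).[x] / 1 * weight alpha beta l x)).
  have dw := is_deriveM (is_derive_cst (p.[x] / 1) l (1 : R))
    (is_derive_weight_param x l).
  apply: (@is_derive_eq _ _ _ (f ^~ x) _ _ _ _ dw).
  by rewrite hornerM hornerX /GRing.scale/=; ring.
have dfE (l x : R) : (partial1of2 f) l x = - (('X * p).[x] / 1 * weight alpha beta l x).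
  by rewrite partial1of2E; have [_ <-] := df l x.
have [C pC] := @horner_bounded R ('X * p).
have C0 : 0 <= C by apply: le_trans (pC 0 _); rewrite ?normr_ge0// lexx ler01.
(* A dominating constant for parameters within distance [1] of [t]: [C] bounds ['X * p] on the unit
   interval, and the weight is at most the exponential. *)
pose G (x : R) := C * expR (`|t| + 1).
have It : `]t - 1, t + 1[%classic t by rewrite /= in_itv/=; apply/andP; split; lra.
have intf (l : R) : `]t - 1, t + 1[%classic l -> mu.-integrable `[0, 1] (EFin \o f l).
  by move=> _; exact: integrable_horner_weight.
have derf (l y : R) : `]t - 1, t + 1[%classic l -> `[0, 1]%classic y ->
    derivable (f ^~ y) l 1.
  by move=> _ _; have [] := df l y.
have G0 y : 0 <= G y by rewrite mulr_ge0 ?expR_ge0.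
have intG : mu.-integrable `[0, 1] (EFin \o G).
  apply: continuous_compact_integrable; first exact: segment_compact.
  by apply: continuous_subspaceT => x; exact: cvg_cst.
have Gub (l y : R) : `]t - 1, t + 1[%classic l -> `[0, 1]%classic y ->
    `|partial1of2 f l y| <= G y.
  rewrite /= !in_itv/= => lt y01; rewrite dfE normrN divr1 normrM /G.
  apply: ler_pM => //; first exact: pC.
  rewrite ger0_norm ?weight_ge0//.
  have [wy _] := @weight_le R alpha beta l alpha_gt0 beta_gt0 y y01.
  rewrite (le_trans wy)// -[X in _ <= X]mul1r ler_pM ?powR_ge0 ?expR_ge0//.
    exact: powR_le1.
  rewrite ler_expR -lerBlDl (le_trans (lerB_dist _ _))// ler_norml.
  by move: lt => /andP[]; lra.
have E := @differentiation_under_integral R _ _ mu f _ (measurable_itv `[0, 1])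
  t _ _ It intf derf G G0 intG Gub.
have D := @derivable_under_integral R _ _ mu f _ (measurable_itv `[0, 1])
  t _ _ It intf derf G G0 intG Gub.
apply: DeriveDef; first exact: D.
rewrite -derive1E [LHS]E /wfun /wint -mulN1r -RintegralZl//.
  by apply: eq_Rintegral => x _; rewrite dfE mulN1r.
exact: integrable_horner_weight.
Qed.

End ParameterDerivative.

(** * Dependence on the parameter *)

Section RealDerivatives.
Local Open Scope classical_set_scope.
Local Open Scope ring_scope.
Context {R : realType}.
Implicit Types (f g : R -> R) (x df dg c : R).

Lemma is_derive1_add f g x df dg : is_derive x 1 f df -> is_derive x 1 g dg ->
  is_derive x 1 (fun y => f y + g y) (df + dg).
Proof. exact: is_deriveD. Qed.

Lemma is_derive1_sub f g x df dg : is_derive x 1 f df -> is_derive x 1 g dg ->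
  is_derive x 1 (fun y => f y - g y) (df - dg).
Proof. exact: is_deriveB. Qed.

Lemma is_derive1_mul f g x df dg : is_derive x 1 f df -> is_derive x 1 g dg ->
  is_derive x 1 (fun y => f y * g y) (df * g x + f x * dg).
Proof.
move=> dfx dgx; apply: is_derive_eq (is_deriveM dfx dgx) _.
by rewrite /GRing.scale/=; ring.
Qed.

Lemma is_derive1_div f g x df dg : g x != 0 ->
  is_derive x 1 f df -> is_derive x 1 g dg ->
  is_derive x 1 (fun y => f y / g y) ((df * g x - f x * dg) / g x ^+ 2).
Proof.
move=> gx dfx dgx.
apply: is_derive_eq (is_derive1_mul dfx (is_deriveV gx dgx)) _.
by rewrite /GRing.scale/=; field.
Qed.

Lemma is_derive1_cst c x : is_derive x 1 (fun=> c) 0.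
Proof. exact: is_derive_cst. Qed.

Lemma is_derive1_id x : is_derive x 1 (fun y => y) 1.
Proof. exact: is_derive_id. Qed.

Lemma is_derive1_sum n (h : nat -> R -> R) (dh : nat -> R) x :
  (forall i, is_derive x 1 (h i) (dh i)) ->
  is_derive x 1 (fun y => \sum_(i < n) h i y) (\sum_(i < n) dh i).
Proof.
move=> dhx; rewrite (_ : (fun y => _) = \sum_(i < n) h i).
  by apply: is_derive_sum => i; exact: dhx.
by apply/funext => y; rewrite fct_sumE.
Qed.

End RealDerivatives.

Section PolynomialFamilies.
Local Open Scope classical_set_scope.
Local Open Scope ring_scope.
Context {R : realType}.
Implicit Types (Q S : R -> {poly R}) (dQ dS : {poly R}).

(* The uniform bound on the size makes evaluation of a linear functional a
   fixed finite sum, hence differentiable. *)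
Definition poly_derive (t : R) Q dQ := exists m,
  [/\ forall s, (size (Q s) <= m)%N, (size dQ <= m)%N &
      forall i, is_derive t 1 (fun s => (Q s)`_i) dQ`_i].

Lemma poly_derive_cst t (q : {poly R}) : poly_derive t (fun=> q) 0.
Proof.
exists (size q); split => // [|i]; first by rewrite size_poly0.
by rewrite coef0; exact: is_derive1_cst.
Qed.

Lemma poly_deriveM t Q S dQ dS : poly_derive t Q dQ -> poly_derive t S dS ->
  poly_derive t (fun s => Q s * S s) (dQ * S t + Q t * dS).
Proof.
move=> [m [sQ sdQ Qd]] [n [sS sdS Sd]]; exists (m + n)%N.
have sM (p q : {poly R}) : (size p <= m)%N -> (size q <= n)%N ->
    (size (p * q)%R <= m + n)%N.
  move=> pm qn; rewrite (leq_trans (size_polyMleq _ _))//.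
  by rewrite (leq_trans (leq_pred _))// leq_add.
split => [s||i]; first exact: sM.
  by rewrite (leq_trans (size_polyD _ _))// geq_max !sM.
rewrite coefD !coefM -big_split/=.
rewrite (_ : (fun s => _) = (fun s => \sum_(j < i.+1) (Q s)`_j * (S s)`_(i - j))).
  apply: (@is_derive1_sum R i.+1 (fun j s => (Q s)`_j * (S s)`_(i - j))
    (fun j => dQ`_j * (S t)`_(i - j) + (Q t)`_j * dS`_(i - j))) => j.
  exact: is_derive1_mul.
by apply/funext => s; rewrite coefM.
Qed.

(** Expand on monomials and apply the product rule termwise: the moving coefficients give [L t dQ],
    the moving functional gives [- L t ('X * Q t)]. *)
Lemma is_derive_linear_poly (L : R -> {scalar {poly R}}) (t : R) Q dQ :
  (forall p (s : R), is_derive s 1 (fun s => L s p) (- L s ('X * p))) ->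
  poly_derive t Q dQ ->
  is_derive t 1 (fun s => L s (Q s)) (L t dQ - L t ('X * Q t)).
Proof.
move=> Ld [m [sQ sdQ Qd]].
have polyE (q : {poly R}) : (size q <= m)%N -> q = \sum_(i < m) q`_i *: 'X^i.
  move=> sq; rewrite -poly_def; apply/polyP => i; rewrite coef_poly.
  by case: ltnP => // mi; rewrite nth_default// (leq_trans sq).
have expand (K : {scalar {poly R}}) (q : {poly R}) : (size q <= m)%N ->
    K q = \sum_(i < m) q`_i * K 'X^i.
  move=> sq; rewrite {1}(polyE _ sq) linear_sum/=.
  by apply: eq_bigr => i _; rewrite linearZ.
have -> : L t ('X * Q t) = \sum_(i < m) (Q t)`_i * L t ('X * 'X^i).
  rewrite {1}(polyE _ (sQ t)) mulr_sumr linear_sum/=.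
  by apply: eq_bigr => i _; rewrite -scalerAr linearZ.
rewrite (expand _ _ sdQ) -sumrN -big_split/=.
rewrite (_ : (fun s => _) = (fun s => \sum_(i < m) (Q s)`_i * L s 'X^i)).
  apply: (@is_derive1_sum R m (fun i s => (Q s)`_i * L s 'X^i)
    (fun i => dQ`_i * L t 'X^i - (Q t)`_i * L t ('X * 'X^i))) => i.
  by rewrite -mulrN; exact: is_derive1_mul.
by apply/funext => s; exact: expand.
Qed.

End PolynomialFamilies.

(** * The first order system for R_n and r_n *)

Section OrthogonalFamily.
Local Open Scope classical_set_scope.
Local Open Scope ring_scope.
Context {R : realType} {L M N : R -> {scalar {poly R}}} {P : R -> nat -> {poly R}}.
Context {a b : R}.
Hypothesis P_monic : forall t n, P t n \is monic.
Hypothesis P_size : forall t n, size (P t n) = n.+1.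
Hypothesis P_orth : forall t m n, m <> n -> L t (P t m * P t n) = 0.
Hypothesis L_pos : forall t (Q : {poly R}), Q != 0 -> 0 < L t (Q * Q).
Hypothesis M_pos : forall t (Q : {poly R}), Q != 0 -> 0 < M t (Q * Q).
Hypothesis N_pos : forall t (Q : {poly R}), Q != 0 -> 0 < N t (Q * Q).
Hypothesis M_mulX : forall t Q, M t ('X * Q) = a * L t Q.
Hypothesis N_mulX1 : forall t Q, N t ((1 - 'X) * Q) = b * L t Q.
Hypothesis pearson : forall t (Q : {poly R}), L t Q^`() + M t Q - N t Q = t * L t Q.
Hypothesis L_derive : forall p (t : R),
  is_derive t 1 (fun s => L s p) (- L t ('X * p)).

Let L_sqr0 t (Q : {poly R}) : Q != 0 -> L t (Q * Q) != 0.
Proof. by move=> /(L_pos t); exact: lt0r_neq0. Qed.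

Local Notation h n := (fun t => sqnorm (L t) (P t) n).
Local Notation ra n := (fun t => rec_a (L t) (P t) n).
Local Notation rb n := (fun t => rec_b (L t) (P t) n).

Let h_neq0 t n : h n t != 0.
Proof. exact: sqnorm_neq0 (P_monic t) (L_sqr0 t) n. Qed.

Let L_low t n (Q : {poly R}) : (size Q <= n)%N -> L t (P t n * Q) = 0.
Proof. by have H := orth_low (P_monic t) (P_size t) (P_orth t); exact: H. Qed.

Let coef_derivable n := forall i (t : R), derivable (fun s => (P s n)`_i) t 1.

(** The sum stops below degree [n] because the leading coefficient is constantly [1]; this low
    degree makes the derivative orthogonal to [P t n]. *)
Definition derP n (t : R) : {poly R} :=
  \poly_(i < n) (fun s => (P s n)`_i)^`()%classic t.

Lemma poly_deriveP n (t : R) : coef_derivable n ->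
  poly_derive t (fun s => P s n) (derP n t).
Proof.
move=> Pd; exists n.+1; split => [s||i]; first by rewrite P_size.
  exact: leqW (size_poly _ _).
rewrite coef_poly; case: ltngtP => [lt_in|ni|->].
- by apply: DeriveDef => //; rewrite derive1E.
- rewrite (_ : (fun s => _) = (fun=> 0)); first exact: is_derive1_cst.
  by apply/funext => s; rewrite nth_default// P_size.
- rewrite (_ : (fun s => _) = (fun=> 1)); first exact: is_derive1_cst.
  by apply/funext => s; rewrite (coef_lead (P_monic s))//; exact: P_size.
Qed.

Lemma size_derP n (t : R) : (size (derP n t) <= n)%N.
Proof. exact: size_poly. Qed.

Lemma L_derP n (t : R) : L t (P t n * derP n t) = 0.
Proof. exact/L_low/size_derP. Qed.

(** Both terms containing [derP n t] vanish by orthogonality, so only the derivative of the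
    functional remains. Differentiability of the coefficients is a premise because this feeds the
    induction that proves it. *)
Let is_derive_sqnorm_of n (t : R) : coef_derivable n ->
  is_derive t 1 (h n) (- (ra n t * h n t)).
Proof.
move=> Pd; have dP := poly_deriveP t Pd.
apply: is_derive_eq (is_derive_linear_poly L_derive (poly_deriveM dP dP)) _.
by rewrite linearD/= [derP n t * _]mulrC L_derP addr0 add0r divfK ?h_neq0.
Qed.

Let derivable_of (f : R -> R) (t df : R) : is_derive t 1 f df -> derivable f t 1.
Proof. by case. Qed.

Let rec_a_derivable_of n (t : R) : coef_derivable n -> derivable (ra n) t 1.
Proof.
move=> Pd; have dP := poly_deriveP t Pd.
have dX := poly_deriveM (poly_derive_cst t 'X) (poly_deriveM dP dP).
exact: derivable_of (is_derive1_div (h_neq0 t n) (is_derive_linear_poly L_derive dX)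
  (is_derive_sqnorm_of t Pd)).
Qed.

(** The recurrence builds [P n.+1] from the two preceding polynomials, with coefficients that are
    quotients of values of [L] at polynomials already known to be differentiable; hence the
    induction over pairs of consecutive degrees. *)
Let coef_derivable_all n : coef_derivable n.
Proof.
suff : coef_derivable n /\ coef_derivable n.+1 by case.
have step k : coef_derivable k ->
    (forall i (t : R), derivable (fun s => rb k s * (prevP (P s) k)`_i) t 1) ->
    coef_derivable k.+1.
  move=> Pk Pk1 i t.
  rewrite (_ : (fun s => _) = (fun s => (if i == 0%N then 0 else (P s k)`_i.-1)
      - ra k s * (P s k)`_i - rb k s * (prevP (P s) k)`_i)).
    apply: derivableB; last exact: Pk1.
    apply: derivableB.
      by case: (i == 0%N); [exact: derivable_cst|exact: Pk].
    by apply: derivableM; [exact: rec_a_derivable_of|exact: Pk].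
  apply/funext => s.
  rewrite (three_term (P_monic s) (P_size s) (P_orth s) (L_sqr0 s)).
  by rewrite !coefB !coefZ coefXM.
elim: n => [|n [IHn IHSn]].
  have P0 : coef_derivable 0.
    move=> i t; rewrite (_ : (fun s => _) = (fun=> (1 : {poly R})`_i)).
      exact: derivable_cst.
    apply/funext => s; congr (nth _ _ _).
    have s0 := size1_polyC (eq_leq (P_size s 0)).
    by rewrite s0 (coef_lead (P_monic s) (P_size s)).
  split => //; apply: step => // i t.
  rewrite (_ : (fun s => _) = (fun=> 0)); first exact: derivable_cst.
  by apply/funext => s; rewrite /= mul0r.
split => //; apply: step => // i t; apply: derivableM; last exact: IHn.
exact: derivable_of (is_derive1_div (h_neq0 t n) (is_derive_sqnorm_of t IHSn)
  (is_derive_sqnorm_of t IHn)).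
Qed.

Lemma is_derive_sqnorm n (t : R) : is_derive t 1 (h n) (- (ra n t * h n t)).
Proof. exact: is_derive_sqnorm_of. Qed.

(** Differentiate the orthogonality of [P n.+1] and [P n]. The derivative of [P n.+1] contributes
    p_(n+1)' h_n, that of [P n] contributes nothing by degree, and the functional contributes -
    h_(n+1). *)
Lemma is_derive_sublead n (t : R) : is_derive t 1 (fun s => sublead (P s) n) (rb n t).
Proof.
case: n => [|n]; first exact: is_derive1_cst.
have dPn := poly_deriveP t (@coef_derivable_all n).
have dPSn := poly_deriveP t (@coef_derivable_all n.+1).
have := is_derive_linear_poly L_derive (poly_deriveM dPSn dPn).
have -> : (fun s => L s (P s n.+1 * P s n)) = (fun=> 0).
  by apply/funext => s; rewrite P_orth//; exact/nesym/n_Sn.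
move=> [_]; rewrite (derive_cst (0 : R)) linearD/= mulrC.
rewrite (orth_lead (P_monic t) (P_size t) (P_orth t)); last exact: size_derP.
rewrite L_low; last exact: leqW (size_derP n t).
rewrite (L_X_succ (P_monic t) (P_size t) (P_orth t)) addr0 => /esym/eqP.
rewrite subr_eq0 => /eqP e.
have [m [_ _ /(_ n)]] := dPSn; rewrite /rec_b -e.
by rewrite mulfK//; exact: h_neq0.
Qed.

Lemma is_derive_rec_b n (t : R) :
  is_derive t 1 (rb n) (rb n t * (ra n.-1 t - ra n t)).
Proof.
case: n => [|n]; first by rewrite /= mul0r; exact: is_derive1_cst.
have h0 := h_neq0 t n.
apply: is_derive_eq
  (is_derive1_div h0 (is_derive_sqnorm n.+1 t) (is_derive_sqnorm n t)) _.
by rewrite /rec_b/=; field.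
Qed.

Local Notation auxR n := (fun t => auxR (L t) (P t) (M t) n).
Local Notation auxr n := (fun t => auxr (L t) (P t) (M t) n).

Lemma auxR_gt n t : 0 < auxR n t /\ t < auxR n t.
Proof.
have hgt0 : 0 < sqnorm (L t) (P t) n by apply: L_pos; exact: P_neq0 (P_monic t) n.
have Pn0 := P_neq0 (P_monic t) n.
split; first by rewrite divr_gt0// M_pos.
rewrite -subr_gt0 -(N_sqr_quotient (P_monic t) (P_size t) (P_orth t) (L_sqr0 t) (pearson t)).
by rewrite divr_gt0// N_pos.
Qed.

Lemma auxR_sublead n t : auxR n t =
  2 * n%:R + 1 + a + b + t - t * (sublead (P t) n - sublead (P t) n.+1).
Proof.
rewrite -(rec_aE (P_monic t) (P_size t) (P_orth t) (L_sqr0 t)).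
rewrite (auxR_rec_a (P_monic t) (P_size t) (P_orth t) (L_sqr0 t)
  (M_mulX t) (N_mulX1 t) (pearson t)).
by ring.
Qed.

Lemma auxr_rec_b n t : auxr n t = - n%:R - sublead (P t) n - t * rb n t.
Proof.
exact: (auxr_sublead (P_monic t) (P_size t) (P_orth t) (L_sqr0 t)
  (M_mulX t) (N_mulX1 t) (pearson t)).
Qed.

(** Differentiating [auxR_sublead] gives R_n' = r_n - r_(n+1). Then [auxr_succ] eliminates r_(n+1),
    and [auxR_rec_a], divided by [t], eliminates a_n. *)
Lemma is_derive_auxR n (t : R) : t != 0 ->
  is_derive t 1 (auxR n) (2 * auxr n t - a +
    (2 * n%:R + 1 + a + b + t - auxR n t) * auxR n t / t).
Proof.
move=> t0.
rewrite (_ : auxR n = fun s => 2 * n%:R + 1 + a + b + s -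
    s * (sublead (P s) n - sublead (P s) n.+1)); last first.
  by apply/funext => s; exact: auxR_sublead.
have d := is_derive1_sub
  (is_derive1_add (is_derive1_cst (2 * n%:R + 1 + a + b) t) (is_derive1_id t))
  (is_derive1_mul (is_derive1_id t)
    (is_derive1_sub (is_derive_sublead n t) (is_derive_sublead n.+1 t))).
apply: is_derive_eq d _.
have e := auxr_succ (P_monic t) (P_size t) (P_orth t) (L_sqr0 t) (M_mulX t) n.
have ea := auxR_rec_a (P_monic t) (P_size t) (P_orth t) (L_sqr0 t)
  (M_mulX t) (N_mulX1 t) (pearson t) n.
have ep := rec_aE (P_monic t) (P_size t) (P_orth t) (L_sqr0 t) n.
rewrite -auxR_sublead -ea -ep.
have -> : t * ra n t * auxR n t / t = ra n t * auxR n t by field.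
have r1E := auxr_rec_b n.+1 t; have r0E := auxr_rec_b n t.
rewrite -natr1 in r1E; move: e r0E r1E ep => /=; set p1 := nth _ _ _.
rewrite -[sqnorm _ _ n.+1 / _]/(rec_b (L t) (P t) n.+1).
lra.
Qed.

(** Differentiating [auxr_rec_b] gives r_n' = b_n (R_(n-1) - R_n). The two quadratic relations are
    linear in b_n and b_n R_(n-1), which expresses this through R_n and r_n alone. *)
Lemma is_derive_auxr n (t : R) : t != 0 ->
  is_derive t 1 (auxr n)
   ((auxr n t ^+ 2 - a * auxr n t) / auxR n t
    - (auxr n t ^+ 2 - a * auxr n t) / t
    + auxR n t * ((auxr n t + n%:R) * (auxr n t + n%:R + b))
      / (auxR n t - t) / t).
Proof.
move=> t0.
have [R0 Rt] := auxR_gt n t.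
rewrite (_ : auxr n = fun s => - n%:R - sublead (P s) n - s * rb n s); last first.
  by apply/funext => s; exact: auxr_rec_b.
have d := is_derive1_sub
  (is_derive1_sub (is_derive1_cst (- n%:R) t) (is_derive_sublead n t))
  (is_derive1_mul (is_derive1_id t) (is_derive_rec_b n t)).
apply: is_derive_eq d _.
have e0 := auxr_quadratic0 (P_monic t) (P_size t) (P_orth t) (L_sqr0 t) (M_mulX t) n.
have e1 := auxr_quadratic1 (P_monic t) (P_size t) (P_orth t) (L_sqr0 t)
  (N_mulX1 t) (pearson t) n.
rewrite (_ : auxr n t ^+ 2 - a * auxr n t = auxr n t * (auxr n t - a)); last by ring.
cbv beta; rewrite e0 e1.
have Rn0 : auxR n t != 0 by rewrite gt_eqF.
have Rtn0 : auxR n t - t != 0 by rewrite gt_eqF// subr_gt0.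
case: n {e0 e1 R0 Rt} Rn0 Rtn0 => [|n] Rn0 Rtn0.
  by rewrite /rec_b/=; field; rewrite Rn0 Rtn0 t0.
have ea k := auxR_rec_a (P_monic t) (P_size t) (P_orth t) (L_sqr0 t)
  (M_mulX t) (N_mulX1 t) (pearson t) k.
have -> : t * (rb n.+1 t * (ra n t - ra n.+1 t)) =
    rb n.+1 t * (t * ra n t - t * ra n.+1 t) by ring.
rewrite !ea -natr1.
by field; rewrite Rn0 Rtn0 t0.
Qed.

End OrthogonalFamily.

(** * Second derivatives along the first order system *)

Section RiccatiSystem.
Local Open Scope classical_set_scope.
Local Open Scope ring_scope.
Context {R : realType} (a b N : R) (X r : R -> R).
Hypotheses (X_gt0 : forall s, 0 < X s) (X_gt : forall s, s < X s).

Definition riccatiX s :=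
  2 * r s - a + (2 * N + 1 + a + b + s - X s) * X s / s.
Definition riccatir s :=
  (r s ^+ 2 - a * r s) / X s - (r s ^+ 2 - a * r s) / s
    + X s * ((r s + N) * (r s + N + b)) / (X s - s) / s.

Hypothesis dX : forall s : R, s != 0 -> is_derive s 1 X (riccatiX s).
Hypothesis dr : forall s : R, s != 0 -> is_derive s 1 r (riccatir s).

Let near_neq0 (t : R) : t != 0 -> \forall s \near t, s != 0.
Proof. by move=> t0; exact: open_neq. Qed.

Lemma is_derive_riccatiX (t : R) : t != 0 ->
  is_derive t 1 (X^`())%classic (2 * riccatir t +
     ((1 - riccatiX t) * X t + (2 * N + 1 + a + b + t - X t) * riccatiX t) / t
    - (2 * N + 1 + a + b + t - X t) * X t / t ^+ 2).
Proof.
(* The formula for the first derivative holds only away from zero, which is enough in a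
   neighbourhood of [t]. *)
move=> t0; apply: (@near_eq_is_derive _ _ _ riccatiX).
  near=> s; have s0 : s != 0 by near: s; exact: near_neq0.
  by rewrite derive1E; have [_ ->] := dX s0.
have d1 := is_derive1_sub (is_derive1_mul (is_derive1_cst 2 t) (dr t0))
  (is_derive1_cst a t).
have d2 := is_derive1_sub (is_derive1_add (is_derive1_cst (2 * N + 1 + a + b) t)
  (is_derive1_id t)) (dX t0).
have d3 := is_derive1_div t0 (is_derive1_mul d2 (dX t0)) (is_derive1_id t).
apply: is_derive_eq (is_derive1_add d1 d3) _.
by field.
Unshelve. all: by end_near. Qed.

(** The second equation of the system says that [s] times the derivative of [r] is
    [B s * T s - A s / T s]. The relation displayed is the derivative of this product form, as
    [rn_second_order] expects it. *)
Lemma is_derive_riccatir (t : R) : t != 0 -> exists2 r2,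
  is_derive t 1 (r^`())%classic r2 &
  riccatir t + t * r2 =
    (2 * r t + 2 * N + b) * riccatir t * (X t / (X t - t))
     - (2 * r t - a) * riccatir t / (X t / (X t - t))
     + ((r t + N) * (r t + N + b)
        + (r t ^+ 2 - a * r t) / (X t / (X t - t)) ^+ 2)
       * (riccatiX t / (X t - t) - X t * (riccatiX t - 1) / (X t - t) ^+ 2).
Proof.
move=> t0.
have X0 s : X s != 0 by rewrite gt_eqF.
have Xs s : X s - s != 0 by rewrite gt_eqF// subr_gt0.
pose A s := r s * r s - a * r s.
pose B s := (r s + N) * (r s + N + b).
pose T s := X s / (X s - s).
have T0 : T t != 0 by rewrite mulf_neq0// invr_neq0.
have dA := is_derive1_sub (is_derive1_mul (dr t0) (dr t0))
  (is_derive1_mul (is_derive1_cst a t) (dr t0)).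
have drN := is_derive1_add (dr t0) (is_derive1_cst N t).
have dB := is_derive1_mul drN (is_derive1_add drN (is_derive1_cst b t)).
have dT := @is_derive1_div R X (fun y => X y - y) t _ _ (Xs t) (dX t0)
  (is_derive1_sub (dX t0) (is_derive1_id t)).
have dE := @is_derive1_div R _ (fun y => y) t _ _ t0
  (is_derive1_sub (is_derive1_mul dB dT) (@is_derive1_div R A T t _ _ T0 dA dT))
  (is_derive1_id t).
have rE s : s != 0 -> riccatir s = (B s * T s - A s / T s) / s.
  move=> s0; rewrite /riccatir /A /B /T; field.
  by rewrite s0 X0 Xs.
pose D := (2 * r t + 2 * N + b) * riccatir t * (X t / (X t - t))
     - (2 * r t - a) * riccatir t / (X t / (X t - t))
     + ((r t + N) * (r t + N + b)
        + (r t ^+ 2 - a * r t) / (X t / (X t - t)) ^+ 2)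
       * (riccatiX t / (X t - t) - X t * (riccatiX t - 1) / (X t - t) ^+ 2).
exists ((D - riccatir t) / t); last by rewrite mulrC divfK// addrC subrK.
apply: (@near_eq_is_derive _ _ _ (fun s => (B s * T s - A s / T s) / s)).
  near=> s; have s0 : s != 0 by near: s; exact: near_neq0.
  by rewrite derive1E; have [_ ->] := dr s0; rewrite rE.
apply: is_derive_eq dE _.
have -> : D - riccatir t = D - (B t * T t - A t / T t) / t by rewrite rE.
rewrite /D /A /B /T; field.
by rewrite t0 X0 Xs.
Unshelve. all: by end_near. Qed.

End RiccatiSystem.

(** * The two second order equations *)

Theorem theorem2p5 (R : realType) (alpha beta : R) (P : R -> nat -> {poly R})
    (alpha_gt0 : 0 < alpha) (beta_gt0 : 0 < beta)
    (P_orth : forall lambda : R, monic_orthogonal (weight alpha beta lambda) (P lambda))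
    (n : nat) (lambda : R) (lambda_neq0 : lambda != 0) :
  let N : R := n%:R in
  let Rf : R -> R := Rn alpha beta P n in
  let rf : R -> R := rn alpha beta P n in
  let R0 := Rf lambda in
  let R1 := (Rf^`())%classic lambda in
  let R2 := (Rf^`()^`())%classic lambda in
  let r0 := rf lambda in
  let r1 := (rf^`())%classic lambda in
  let r2 := (rf^`()^`())%classic lambda in
  [/\ derivable Rf lambda 1 /\ derivable (Rf^`())%classic lambda 1,
      derivable rf lambda 1 /\ derivable (rf^`())%classic lambda 1,
      2 * lambda ^+ 2 * (R0 - lambda) * R0 != 0,
      R2 = 1 / (2 * lambda ^+ 2 * (R0 - lambda) * R0) *
        ((2 * R0 - lambda) * (lambda * R1) ^+ 2 - 2 * lambda * R0 ^+ 2 * R1 + 2 * R0 ^+ 5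
         - 2 * alpha ^+ 2 * lambda ^+ 2 * R0 + alpha ^+ 2 * lambda ^+ 3
         - (2 * (2 * N + 1 + alpha + beta) + 5 * lambda) * R0 ^+ 4
         + 4 * lambda * (2 * N + 1 + alpha + beta + lambda) * R0 ^+ 3
         - (lambda ^+ 3 - lambda * (1 + alpha ^+ 2 - beta ^+ 2)
            + 2 * lambda ^+ 2 * (2 * N + 1 + alpha + beta)) * R0 ^+ 2)
    & (lambda ^+ 2 * r2 + 8 * r0 ^+ 3 + 6 * (2 * N - alpha + beta) * r0 ^+ 2
       + 4 * (N ^+ 2 - 2 * N * alpha + N * beta - alpha * beta) * r0
       - 2 * N * (N + beta) * alpha + lambda * r1) ^+ 2
      = (4 * r0 + lambda + 2 * N - alpha + beta) ^+ 2
        * (4 * r0 * (r0 - alpha) * (r0 + N) * (r0 + N + beta) + (lambda * r1) ^+ 2)].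
Proof.
move=> N Rf rf R0 R1 R2 r0 r1 r2.
(* The concrete functionals; [K] is the integral against [beta w / (1 - y)], since [N] here denotes
   the degree as a real number. *)
pose L t := wfun_scalar (integrable_horner_weight t alpha_gt0 beta_gt0) 1.
pose M t := wfun_scalar (integrable_horner_weight_div t alpha_gt0 beta_gt0) alpha.
pose K t := wfun_scalar (integrable_horner_weight_div_onem t alpha_gt0 beta_gt0) beta.
have LE t p : L t p = wfun alpha beta t (cst 1) p.
  by rewrite -[LHS]/(1 * _) mul1r.
have P_monic t k : P t k \is monic by have [/(_ k)[]] := P_orth t.
have P_size t k : size (P t k) = k.+1 by have [/(_ k)[]] := P_orth t.
have P_orthL t m k : m <> k -> L t (P t m * P t k) = 0.
  move=> mk; have [_ /(_ m k mk) <-] := P_orth t; rewrite LE.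
  by apply: eq_Rintegral => x _; rewrite hornerM divr1.
have L_sqr t (Q : {poly R}) : Q != 0 -> 0 < L t (Q * Q).
  move=> Q0; rewrite LE; apply: wfun_sqr_gt0 => //.
  exact: integrable_horner_weight.
have M_sqr t (Q : {poly R}) : Q != 0 -> 0 < M t (Q * Q).
  move=> Q0; apply: mulr_gt0 => //; apply: wfun_sqr_gt0 => //.
    exact: integrable_horner_weight_div.
  by move=> x /andP[].
have K_sqr t (Q : {poly R}) : Q != 0 -> 0 < K t (Q * Q).
  move=> Q0; apply: mulr_gt0 => //; apply: wfun_sqr_gt0 => //.
    exact: integrable_horner_weight_div_onem.
  by move=> x /andP[_]; rewrite subr_gt0.
have M_mulX t (Q : {poly R}) : M t ('X * Q) = alpha * L t Q.
  by rewrite LE -(wfun_mulX _ _ alpha_gt0).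
have K_mulX t (Q : {poly R}) : K t ((1 - 'X) * Q) = beta * L t Q.
  by rewrite LE -(wfun_mul_onemX _ _ beta_gt0).
have pearson t (Q : {poly R}) : L t Q^`() + M t Q - K t Q = t * L t Q.
  by rewrite !LE; exact: wfun_pearson.
have L_derive (p : {poly R}) (t : R) :
    is_derive t 1 (fun s => L s p) (- L t ('X * p)).
  rewrite LE; rewrite (_ : (fun s => L s p) = (fun s => wfun alpha beta s (cst 1) p)).
    exact: is_derive_wfun_param.
  by apply/funext => s; exact: LE.
have LPP t k : sqnorm (L t) (P t) k = hnorm alpha beta P k t.
  rewrite /sqnorm LE; apply: eq_Rintegral => x _.
  by rewrite hornerM divr1 expr2.
have RfE : Rf = fun t => auxR (L t) (P t) (M t) n.
  apply/funext => t; rewrite /auxR LPP /Rf /Rn mulrAC; congr (_ * _ / _).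
  by apply: eq_Rintegral => x _; rewrite hornerM expr2.
have rfE : rf = fun t => auxr (L t) (P t) (M t) n.
  apply/funext => t; rewrite /rf /rn /auxr; case: (n) => // k.
  rewrite LPP mulrAC; congr (_ * _ / _).
  by apply: eq_Rintegral => x _; rewrite hornerM.
have Rf_gt t : 0 < Rf t /\ t < Rf t.
  by rewrite RfE; exact: (auxR_gt P_monic P_size P_orthL L_sqr M_sqr K_sqr pearson n t).
have dR (t : R) : t != 0 -> is_derive t 1 Rf (riccatiX alpha beta N Rf rf t).
  move=> t0; rewrite RfE rfE.
  exact: (is_derive_auxR P_monic P_size P_orthL L_sqr M_mulX K_mulX pearson L_derive n t0).
have dr (t : R) : t != 0 -> is_derive t 1 rf (riccatir alpha beta N Rf rf t).
  move=> t0; rewrite RfE rfE.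
  exact: (is_derive_auxr P_monic P_size P_orthL L_sqr M_sqr K_sqr M_mulX K_mulX
    pearson L_derive n t0).
have X_gt0 t : 0 < Rf t by have [] := Rf_gt t.
have X_gt t : t < Rf t by have [] := Rf_gt t.
have dR2 := is_derive_riccatiX dR dr lambda_neq0.
have [r2' dr2 r2E] := is_derive_riccatir X_gt0 X_gt dR dr lambda_neq0.
have X0 : R0 != 0 := lt0r_neq0 (X_gt0 lambda).
have Xl0 : R0 - lambda != 0 by apply: lt0r_neq0; rewrite subr_gt0; exact: X_gt.
have two0 : (2 : R) != 0 by rewrite pnatr_eq0.
have R1E : R1 = riccatiX alpha beta N Rf rf lambda.
  by rewrite /R1 derive1E; have [_ ->] := dR _ lambda_neq0.
have r1E : r1 = riccatir alpha beta N Rf rf lambda.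
  by rewrite /r1 derive1E; have [_ ->] := dr _ lambda_neq0.
(* From here the elimination lemmas see only field elements: the values of the two functions and of
   their first two derivatives. *)
rewrite -R1E -r1E in dR2 r2E.
split.
- by split; [have [] := dR _ lambda_neq0|have [] := dR2].
- by split; [have [] := dr _ lambda_neq0|have [] := dr2].
- by apply: mulf_neq0 => //; do 2 (apply: mulf_neq0 => //); exact: expf_neq0.
- apply: (@Rn_second_order R alpha beta N lambda R0 r0 R1 r1 R2) => //.
  by rewrite /R2 derive1E; have [_ ->] := dR2.
- apply: (@rn_second_order R alpha beta N lambda R0 r0 R1) => //.
  by rewrite /r2 derive1E; have [_ ->] := dr2.
Qed.
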